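(* For any two predicates $P,Q$ and any concrete program $S$, if $\models_{\mathrm{tot}}\{P\}\,S\,\{Q\}$, then $\{P\}\,\square\,\{Q\}\hookrightarrow_{\mathrm{tot}}^{*}S$.
   Context: Quantum setting. There is a finite set $\mathrm{qVars}$ of quantum variables; each $q$ has Hilbert space $\mathcal H_q=\mathbb C^{\Sigma_q}$ ($\Sigma_q$ finite) with standard orthonormal basis $\{|x\rangle\}_{x\in\Sigma_q}$. For a set $\vec q\subseteq\mathrm{qVars}$, $\mathcal H_{\vec q}=\bigotimes_{q\in\vec q}\mathcal H_q$ with standard basis labelled by $\Sigma_{\vec q}=\prod_{q\in\vec q}\Sigma_q$, and $\mathcal H=\mathcal H_{\mathrm{qVars}}$. For an operator $A$ on $\mathcal H_{\vec q}$, $A_{\vec q}=A\otimes I$ on $\mathcal H$. $\preceq$ is the Löwner order. A partial state is a positive semidefinite (PSD) $\rho$ on $\mathcal H$ with $\operatorname{tr}\rho\le1$. A predicate is an operator $P$ on $\mathcal H$ with $0\preceq P\preceq I$; ''$P\Rightarrow Q$'' means $P\preceq Q$. A measurement on $\vec q$ is a family $\vec M=\{M_\omega\}_{\omega\in\Omega}$ ($\Omega$ finite) of PSD operators on $\mathcal H_{\vec q}$ with $\sum_\omega M_\omega=I$; write $\mathcal M_{\omega}(X)=\sqrt{M_{\omega,\vec q}}\,X\,\sqrt{M_{\omega,\vec q}}$. A binary measurement is given by an operator $B$ on $\mathcal H_{\vec q}$ with $0\preceq B\preceq I$, and $\mathcal B_{0,\vec q}(X)=\sqrt{(I-B)_{\vec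 q}}\,X\sqrt{(I-B)_{\vec q}}$, $\mathcal B_{1,\vec q}(X)=\sqrt{B_{\vec q}}\,X\sqrt{B_{\vec q}}$. Quantum while language: $S::=\mathbf{skip}\mid \vec q:=|0\rangle\mid \vec q\mathrel{*}=U\mid S_1;S_2\mid \mathbf{repeat}\ N\ \mathbf{do}\ S\mid \mathbf{case}\ \vec M[\vec q]\ \mathbf{of}\ \{\omega: S_\omega\}_{\omega\in\Omega}\mid \mathbf{while}\ B[\vec q]\ \mathbf{do}\ S$, with $U$ unitary on $\mathcal H_{\vec q}$, $N\in\mathbb N$. Denotational semantics $[\![S]\!]$ on partial states: $[\![\mathbf{skip}]\!](\rho)=\rho$; $[\![\vec q:=|0\rangle]\!](\rho)=\sum_{x\in\Sigma_{\vec q}}|0\rangle\langle x|_{\vec q}\,\rho\,|x\rangle\langle0|_{\vec q}$; $[\![\vec q\mathrel{*}=U]\!](\rho)=U_{\vec q}\rho U_{\vec q}^\dagger$; $[\![S_1;S_2]\!]=[\![S_2]\!]\circ[\![S_1]\!]$; $[\![\mathbf{repeat}\ N\ \mathbf{do}\ S]\!]=[\![S]\!]^N$; $[\![\mathbf{case}\ldots]\!](\rho)=\sum_\omega[\![S_\omega]\!](\mathcal M_\omega(\rho))$; $[\![\mathbf{while}\ B[\vec q]\ \mathbf{do}\ S]\!](\rho)=\sum_{k\ge0}(\mathcal B_{0,\vec q}\circ([\![S]\!]\circ\mathcal B_{1,\vec q})^k)(\rho)$. Hoare triples: $\models_{\mathrm{tot}}\{P\}S\{Q\}$ iff $\operatorname{tr}(P\rho)\le\operatorname{tr}(Q[\![S]\!](\rho))$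 for all partial states $\rho$; $\models_{\mathrm{par}}\{P\}S\{Q\}$ iff $\operatorname{tr}(P\rho)\le\operatorname{tr}(Q[\![S]\!](\rho))+\operatorname{tr}\rho-\operatorname{tr}[\![S]\!](\rho)$ for all partial states $\rho$. Syntactic sugar: $\mathbf{if}\ B[\vec q]\ \mathbf{then}\ S_1\ \mathbf{else}\ S_0$ abbreviates $\mathbf{case}\ \{1:B,0:I-B\}[\vec q]\ \mathbf{of}\ \{1:S_1,0:S_0\}$; omitting else means $S_0=\mathbf{skip}$. Programs with holes. The grammar is extended by holes $\{P\}\,\square\,\{Q\}$ ($P,Q$ predicates); more generally a hole may carry a family of specifications $\{P_\lambda\}\,\square\,\{Q_\lambda\}$, $\lambda\in\Lambda$ (written e.g. $\{P,P'\}\square\{Q,Q'\}$ for two). A program without holes is concrete. A refinement rule applied to a hole with a family must have its side conditions satisfied for every $\lambda$; the predicates it introduces may depend on $\lambda$, but the syntactic program produced (variables, unitaries, measurements, $N$, $B$) is the same for all $\lambda$; holes it creates carry the families indexed by $\lambda$ together with any newly introduced index. Refinement for partial correctness $\hookrightarrow_{\mathrm{par}}$ (for predicates $P,Q$): (H.skip) $\{P\}\square\{Q\}\hookrightarrow\mathbf{skip}$ if $P\Rightarrow Q$; (H.init) $\{P\}\square\{Q\}\hookrightarrow\vec q:=|0\rangle$ if $P\Rightarrow\sum_{x\in\Sigma_{\vec q}}|x\rangle\langle0|_{\vec q}Q|0\rangle\langle x|_{\vec q}$; (H.unit) $\{P\}\square\{Q\}\hookrightarrow\vec q\mathrel{*}=U$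 if $P\Rightarrow U_{\vec q}^\dagger QU_{\vec q}$; (H.seq) $\{P\}\square\{Q\}\hookrightarrow\{P\}\square\{R\};\{R\}\square\{Q\}$ for any predicate $R$; (HP.split) $\{P\}\square\{Q\}\hookrightarrow\{P_\gamma\}\square\{Q_\gamma\}$ ($\gamma\in\Gamma$) if $P\Rightarrow\sum_\gamma p_\gamma P_\gamma$ and $\sum_\gamma p_\gamma Q_\gamma\Rightarrow Q$ for a probability distribution $(p_\gamma)$; (H.repeat) $\{P\}\square\{Q\}\hookrightarrow\mathbf{repeat}\ N\ \mathbf{do}\ \{R_j\}\square\{R_{j+1}\}$ (family over $j\in\{0,\dots,N-1\}$) for predicates $R_0,\dots,R_N$ with $P\Rightarrow R_0$, $R_N\Rightarrow Q$; (H.case) $\{P\}\square\{Q\}\hookrightarrow\mathbf{case}\ \vec M[\vec q]\ \mathbf{of}\ \{\omega:\{P_\omega\}\square\{Q\}\}_{\omega}$ if $P\Rightarrow\sum_\omega\mathcal M_\omega(P_\omega)$; (HP.while) $\{P\}\square\{Q\}\hookrightarrow\mathbf{while}\ B[\vec q]\ \mathbf{do}\ \{R\}\square\{\mathcal B_{0,\vec q}(Q)+\mathcal B_{1,\vec q}(R)\}$ for a predicate $R$ with $P\Rightarrow\mathcal B_{0,\vec q}(Q)+\mathcal B_{1,\vec q}(R)$. Composite rules: (C.seqL/C.seqR/C.repeat/C.case/C.while) if $S'\hookrightarrow S$ then replacing one occurrence of $S'$ as the left or right component of a sequence, the body of a repeat, one branch of a case, or the body of a while by $S$ is a refinement step.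 Refinement for total correctness $\hookrightarrow_{\mathrm{tot}}$ uses all (H.* ) and (C.* ) rules above but replaces (HP.while) by (HT.while): $\{P\}\square\{Q\}\hookrightarrow\mathbf{while}\ B[\vec q]\ \mathbf{do}\ \{R_{n+1}\}\square\{\mathcal B_{0,\vec q}(Q)+\mathcal B_{1,\vec q}(R_n)\}$ (family over $n\in\mathbb N$) for predicates $(R_n)_{n\in\mathbb N}$ with $R_0=0$, $R_n\Rightarrow R_{n+1}$, whose limit $R=\lim_n R_n$ satisfies $P\Rightarrow\mathcal B_{0,\vec q}(Q)+\mathcal B_{1,\vec q}(R)$; and replaces (HP.split) by (HT.split), identical except that $(p_\gamma)$ need only be nonnegative reals. $\hookrightarrow^k$ denotes $k$ steps and $\hookrightarrow^*$ the reflexive-transitive closure. *)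

(* Defs.v *)
From HB Require Import structures.
From mathcomp Require Import all_boot all_order all_algebra.
From mathcomp Require Import boolp classical_sets reals topology normedtype sequences.
From mathcomp.real_closed Require Import complex.
From Stdlib Require Import Relations.

Set Implicit Arguments.
Unset Strict Implicit.
Unset Printing Implicit Defensive.

Import Order.TTheory GRing.Theory Num.Theory.
Import numFieldNormedType.Exports.
Local Open Scope classical_set_scope.
Local Open Scope ring_scope.

Section QuantumRefinement.

Variable R : realType.
Local Notation C := (R[i]).

(* The finite set qVars of quantum variables, and for each q its finite
   alphabet Sigma_q, with a distinguished element 0 (used by q := |0>). *)
Variable V : finType.
Variable Sig : V -> finType.
Variable zero : forall q, Sig q.

(* Standard basis of H = H_qVars : assignments of a value to every variable. *)
Definition Bas : finType := {dffun forall q : V, Sig q}.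

Definition LBas (qs : {set V}) : finType :=
  {dffun forall q : {x : V | x \in qs}, Sig (sval q)}.

Definition restr (qs : {set V}) (x : Bas) : LBas qs :=
  @finfun _ (fun q : {x : V | x \in qs} => Sig (sval q)) (fun q => x (sval q)).

Definition lzero (qs : {set V}) : LBas qs :=
  @finfun _ (fun q : {x : V | x \in qs} => Sig (sval q)) (fun q => zero (sval q)).

(* Operators on the space C^T (T finite) are square matrices indexed by the
   ranks of the elements of T in the enumeration of T. *)
Definition op (T : finType) := 'M[C]_#|T|.

Definition entry (T : finType) (A : op T) (x y : T) : C := A (enum_rank x) (enum_rank y).

Definition ketbra (T : finType) (a b : T) : op T := delta_mx (enum_rank a) (enum_rank b).

Definition adj m n (A : 'M[C]_(m, n)) : 'M[C]_(n, m) := (map_mx Num.conj A)^T.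

(* Positive semidefinite: <v, A v> >= 0 for every vector v (the order on C:
   0 <= z iff z is a nonnegative real). *)
Definition psd n (A : 'M[C]_n) : Prop :=
  forall v : 'cV[C]_n, 0 <= (adj v *m A *m v) 0 0.

Definition lowner n (A B : 'M[C]_n) : Prop := psd (B - A).

Definition is_pred n (P : 'M[C]_n) : Prop := lowner 0 P /\ lowner P 1%:M.

Definition partial_state n (rho : 'M[C]_n) : Prop := psd rho /\ \tr rho <= 1.

(* The (unique) PSD square root of a PSD operator. *)
Definition sqrtm n (A : 'M[C]_n) : 'M[C]_n :=
  match pselect (exists X : 'M[C]_n, psd X /\ X *m X = A) with
  | left h => proj1_sig (cid h)
  | right _ => 0
  end.

(* A_qs = A (x) I on H *)
Definition lift (qs : {set V}) (A : op (LBas qs)) : op Bas :=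
  \matrix_(i, j)
    (entry A (restr qs (enum_val i)) (restr qs (enum_val j)) *
     ([forall q : V, (q \notin qs) ==> (enum_val i q == enum_val j q)] %:R)).

Definition unitary (T : finType) (U : op T) : Prop :=
  adj U *m U = 1%:M /\ U *m adj U = 1%:M.

(* A measurement on qs with outcome set Omega = 'I_n (any finite outcome set
   is in bijection with some 'I_n). *)
Definition measurement (qs : {set V}) n (M : 'I_n -> op (LBas qs)) : Prop :=
  (forall w, psd (M w)) /\ \sum_(w < n) M w = 1%:M.

Definition Mmap (qs : {set V}) (Mw : op (LBas qs)) (X : op Bas) : op Bas :=
  sqrtm (lift Mw) *m X *m sqrtm (lift Mw).

Definition B0map (qs : {set V}) (B : op (LBas qs)) (X : op Bas) : op Bas :=
  Mmap (1%:M - B) X.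
Definition B1map (qs : {set V}) (B : op (LBas qs)) (X : op Bas) : op Bas :=
  Mmap B X.

Definition op_cvg n (f : nat -> 'M[C]_n) (L : 'M[C]_n) : Prop :=
  forall i j,
    ((fun k => complex.Re (f k i j)) @ \oo --> complex.Re (L i j)) /\
    ((fun k => complex.Im (f k i j)) @ \oo --> complex.Im (L i j)).

Definition op_series n (f : nat -> 'M[C]_n) : 'M[C]_n :=
  \matrix_(i, j)
    (Complex (limn (fun k => complex.Re ((\sum_(m < k) f m) i j)))
             (limn (fun k => complex.Im ((\sum_(m < k) f m) i j)))).

(* Programs with holes. A hole carries a family of specifications indexed by
   an arbitrary type L. The outcome set of a case statement is 'I_n. *)
Inductive prog : Type :=
| Skip : prog
| Init : {set V} -> prog
| Unit : forall qs : {set V}, op (LBas qs) -> prog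
| Seq : prog -> prog -> prog
| Repeat : nat -> prog -> prog
| Case : forall (qs : {set V}) (n : nat), ('I_n -> op (LBas qs)) -> ('I_n -> prog) -> prog
| While : forall qs : {set V}, op (LBas qs) -> prog -> prog
| Hole : forall L : Type, (L -> op Bas) -> (L -> op Bas) -> prog.

Fixpoint concrete (S : prog) : Prop :=
  match S with
  | Skip | Init _ | Unit _ _ => True
  | Seq S1 S2 => concrete S1 /\ concrete S2
  | Repeat _ S1 => concrete S1
  | Case _ n _ Ss => forall w : 'I_n, concrete (Ss w)
  | While _ _ S1 => concrete S1
  | Hole _ _ _ => False
  end.

Fixpoint wf (S : prog) : Prop :=
  match S with
  | Skip | Init _ => True
  | Unit _ U => unitary U
  | Seq S1 S2 => wf S1 /\ wf S2
  | Repeat _ S1 => wf S1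
  | Case _ n M Ss => measurement M /\ forall w : 'I_n, wf (Ss w)
  | While _ B S1 => is_pred B /\ wf S1
  | Hole _ _ _ => True
  end.

Definition init_map (qs : {set V}) (rho : op Bas) : op Bas :=
  \sum_(x : LBas qs) (lift (ketbra (lzero qs) x) *m rho *m lift (ketbra x (lzero qs))).

(* Denotational semantics (holes are given the zero semantics; the semantics
   is only used on concrete programs). *)
Fixpoint sem (S : prog) (rho : op Bas) : op Bas :=
  match S with
  | Skip => rho
  | Init qs => init_map qs rho
  | Unit qs U => lift U *m rho *m adj (lift U)
  | Seq S1 S2 => sem S2 (sem S1 rho)
  | Repeat N S1 => iter N (sem S1) rho
  | Case qs n M Ss => \sum_(w < n) sem (Ss w) (Mmap (M w) rho)
  | While qs B S1 =>
      op_series (fun k => B0map B (iter k (fun X => sem S1 (B1map B X)) rho))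
  | Hole _ _ _ => 0
  end.

Definition models_tot (P : op Bas) (S : prog) (Q : op Bas) : Prop :=
  forall rho : op Bas, partial_state rho ->
    \tr (P *m rho) <= \tr (Q *m sem S rho).

Definition init_pre (qs : {set V}) (Q : op Bas) : op Bas :=
  \sum_(x : LBas qs) (lift (ketbra x (lzero qs)) *m Q *m lift (ketbra (lzero qs) x)).

Inductive rstep_tot : prog -> prog -> Prop :=
| H_skip (L : Type) (P Q : L -> op Bas) :
    (forall l, lowner (P l) (Q l)) ->
    rstep_tot (Hole P Q) Skip
| H_init (L : Type) (P Q : L -> op Bas) (qs : {set V}) :
    (forall l, lowner (P l) (init_pre qs (Q l))) ->
    rstep_tot (Hole P Q) (Init qs)
| H_unit (L : Type) (P Q : L -> op Bas) (qs : {set V}) (U : op (LBas qs)) :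
    unitary U ->
    (forall l, lowner (P l) (adj (lift U) *m Q l *m lift U)) ->
    rstep_tot (Hole P Q) (Unit U)
| H_seq (L : Type) (P Q Rp : L -> op Bas) :
    (forall l, is_pred (Rp l)) ->
    rstep_tot (Hole P Q) (Seq (Hole P Rp) (Hole Rp Q))
| HT_split (L : Type) (P Q : L -> op Bas) (G : finType) (p : L -> G -> R)
    (Pg Qg : L -> G -> op Bas) :
    (forall l g, 0 <= p l g) ->
    (forall l g, is_pred (Pg l g) /\ is_pred (Qg l g)) ->
    (forall l, lowner (P l) (\sum_(g : G) (((p l g)%:C)%C *: Pg l g))) ->
    (forall l, lowner (\sum_(g : G) (((p l g)%:C)%C *: Qg l g)) (Q l)) ->
    rstep_tot (Hole P Q)
      (Hole (fun x : L * G => Pg x.1 x.2) (fun x : L * G => Qg x.1 x.2))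
| H_repeat (L : Type) (P Q : L -> op Bas) (N : nat) (Rj : L -> nat -> op Bas) :
    (forall l j, (j <= N)%N -> is_pred (Rj l j)) ->
    (forall l, lowner (P l) (Rj l 0%N)) ->
    (forall l, lowner (Rj l N) (Q l)) ->
    rstep_tot (Hole P Q)
      (Repeat N (Hole (fun x : L * 'I_N => Rj x.1 x.2)
                      (fun x : L * 'I_N => Rj x.1 x.2.+1)))
| H_case (L : Type) (P Q : L -> op Bas) (qs : {set V}) (n : nat)
    (M : 'I_n -> op (LBas qs)) (Pw : L -> 'I_n -> op Bas) :
    measurement M ->
    (forall l w, is_pred (Pw l w)) ->
    (forall l, lowner (P l) (\sum_(w < n) Mmap (M w) (Pw l w))) ->
    rstep_tot (Hole P Q) (Case M (fun w => Hole (fun l => Pw l w) Q))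
| HT_while (L : Type) (P Q : L -> op Bas) (qs : {set V}) (B : op (LBas qs))
    (Rn : L -> nat -> op Bas) (Rlim : L -> op Bas) :
    is_pred B ->
    (forall l k, is_pred (Rn l k)) ->
    (forall l, Rn l 0%N = 0) ->
    (forall l k, lowner (Rn l k) (Rn l k.+1)) ->
    (forall l, op_cvg (Rn l) (Rlim l)) ->
    (forall l, lowner (P l) (B0map B (Q l) + B1map B (Rlim l))) ->
    rstep_tot (Hole P Q)
      (While B (Hole (fun x : L * nat => Rn x.1 x.2.+1)
                     (fun x : L * nat => B0map B (Q x.1) + B1map B (Rn x.1 x.2))))
| C_seqL (S1 S1' S2 : prog) :
    rstep_tot S1 S1' -> rstep_tot (Seq S1 S2) (Seq S1' S2)
| C_seqR (S1 S2 S2' : prog) :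
    rstep_tot S2 S2' -> rstep_tot (Seq S1 S2) (Seq S1 S2')
| C_repeat (N : nat) (S1 S1' : prog) :
    rstep_tot S1 S1' -> rstep_tot (Repeat N S1) (Repeat N S1')
| C_case (qs : {set V}) (n : nat) (M : 'I_n -> op (LBas qs)) (Ss : 'I_n -> prog)
    (w : 'I_n) (S' : prog) :
    rstep_tot (Ss w) S' ->
    rstep_tot (Case M Ss) (Case M (fun v => if v == w then S' else Ss v))
| C_while (qs : {set V}) (B : op (LBas qs)) (S1 S1' : prog) :
    rstep_tot S1 S1' -> rstep_tot (While B S1) (While B S1').

Definition refines_tot : prog -> prog -> Prop := clos_refl_trans prog rstep_tot.

Definition hole1 (P Q : op Bas) : prog := Hole (fun _ : unit => P) (fun _ : unit => Q).

End QuantumRefinement.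

(* Main.v *)
Require Import Defs.
From HB Require Import structures.
From mathcomp Require Import all_boot all_order all_algebra.
From mathcomp Require Import boolp classical_sets reals topology normedtype sequences.
From mathcomp.real_closed Require Import complex.
From mathcomp Require Import sesquilinear spectral ring lra.
From Stdlib Require Import Relations.

Set Implicit Arguments.
Unset Strict Implicit.
Unset Printing Implicit Defensive.

Import Order.TTheory GRing.Theory Num.Theory.
Import numFieldNormedType.Exports.
Local Open Scope classical_set_scope.
Local Open Scope ring_scope.

(* Every concrete program S has an adjoint with respect to the trace pairing:
   for each predicate Q there is a predicate W = wp S Q with
   tr (Q [[S]](rho)) = tr (W rho) for all PSD rho.  Hence validity of {P} S {Q}
   means P <= wp S Q, and the refinement is read off the structure of S by
   using weakest preconditions as the intermediate predicates (the splitting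
   rule is never used).  For a loop, R_0 = 0 and
   R_(n+1) = wp S (B0 Q + B1 R_n) increase to a limit R, and peeling off the
   first iteration shows that B0 Q + B1 R_n is dual to the sum of the first
   n + 1 terms of the semantics, so that B0 Q + B1 R is dual to the loop. *)

(** * Positive semidefinite matrices *)

Section Matrices.
Variable R : realType.
Local Notation C := (R[i]).

Lemma adjE m n (A : 'M[C]_(m, n)) i j : adj A i j = Num.conj (A j i).
Proof. by rewrite !mxE. Qed.

Lemma adjM m n p (A : 'M[C]_(m, n)) (B : 'M[C]_(n, p)) :
  adj (A *m B) = adj B *m adj A.
Proof. by rewrite /adj map_mxM trmx_mul. Qed.

Lemma adjD m n (A B : 'M[C]_(m, n)) : adj (A + B) = adj A + adj B.
Proof. by rewrite /adj map_mxD linearD. Qed.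

Lemma adjZ m n c (A : 'M[C]_(m, n)) : adj (c *: A) = Num.conj c *: adj A.
Proof. by rewrite /adj map_mxZ linearZ. Qed.

Lemma adjK m n (A : 'M[C]_(m, n)) : adj (adj A) = A.
Proof. by apply/matrixP=> i j; rewrite !mxE conjCK. Qed.

Lemma adj_delta m n i j : adj (delta_mx i j : 'M[C]_(m, n)) = delta_mx j i.
Proof. by apply/matrixP=> k l; rewrite !mxE rmorph_nat andbC. Qed.

Definition sesq n (A : 'M[C]_n) (u v : 'cV[C]_n) : C := (adj u *m A *m v) 0 0.

Lemma sesqDl n (A : 'M[C]_n) u v w : sesq A (u + v) w = sesq A u w + sesq A v w.
Proof. by rewrite /sesq adjD !mulmxDl mxE. Qed.

Lemma sesqDr n (A : 'M[C]_n) u v w : sesq A u (v + w) = sesq A u v + sesq A u w.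
Proof. by rewrite /sesq mulmxDr mxE. Qed.

Lemma sesqZl n (A : 'M[C]_n) c u v : sesq A (c *: u) v = Num.conj c * sesq A u v.
Proof. by rewrite /sesq adjZ -!scalemxAl mxE. Qed.

Lemma sesqZr n (A : 'M[C]_n) c u v : sesq A u (c *: v) = c * sesq A u v.
Proof. by rewrite /sesq -scalemxAr mxE. Qed.

Lemma sesq_delta n (A : 'M[C]_n) i j : sesq A (delta_mx i 0) (delta_mx j 0) = A i j.
Proof. by rewrite /sesq adj_delta -rowE -colE !mxE. Qed.

Definition polar_vec n (i j : 'I_n) (c : C) : 'cV[C]_n := delta_mx i 0 + c *: delta_mx j 0.

Lemma sesq_polar n (A : 'M[C]_n) i j c :
  sesq A (polar_vec i j c) (polar_vec i j c) =
  A i i + c * A i j + Num.conj c * A j i + Num.conj c * c * A j j.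
Proof.
rewrite /polar_vec !(sesqDl, sesqDr, sesqZl, sesqZr) !sesq_delta.
by ring.
Qed.

Lemma psd_diag n (A : 'M[C]_n) i : psd A -> 0 <= A i i.
Proof. by move=> psdA; rewrite -sesq_delta; apply: psdA. Qed.

Lemma psd_diag_Im n (A : 'M[C]_n) i : psd A -> complex.Im (A i i) = 0.
Proof. by move/(psd_diag i); rewrite lecE => /andP[/eqP->]. Qed.

Lemma conj_i : Num.conj 'i%C = - 'i%C :> C.
Proof. by apply/eqP; rewrite eq_complex /= oppr0 !eqxx. Qed.

(* Polarization: real quadratic forms determine the entries, so monotone
   convergence of the former gives entrywise convergence. *)
Lemma psd_polarE n (A : 'M[C]_n) i j : psd A ->
  let d := complex.Re (A i i) + complex.Re (A j j) in
  let q c := complex.Re (sesq A (polar_vec i j c) (polar_vec i j c)) in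
  A i j = Complex ((q 1 - d) / 2) (- (q 'i%C - d) / 2) /\
  A j i = Complex ((q 1 - d) / 2) ((q 'i%C - d) / 2).
Proof.
move=> psdA /=.
have := psdA (polar_vec i j 1); rewrite -/(sesq _ _ _).
have := psdA (polar_vec i j 'i%C); rewrite -/(sesq _ _ _).
rewrite !sesq_polar conj_i rmorph1 !mul1r.
have := psd_diag_Im i psdA; have := psd_diag_Im j psdA.
case: (A i i) => a a'; case: (A j j) => b b' /= -> ->.
case: (A i j) => c c'; case: (A j i) => d d'.
(* Both forms are nonnegative, hence real: [c = 'i] gives equal real parts of [A i j] and [A j i],
   [c = 1] gives opposite imaginary parts. *)
rewrite !lecE /= => /andP[/eqP h1 _] /andP[/eqP h2 _].
by split; apply/eqP; rewrite eq_complex /=; apply/andP; split; apply/eqP; lra.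
Qed.

Lemma psd_adj n (A : 'M[C]_n) : psd A -> adj A = A.
Proof.
move=> psdA; apply/matrixP=> i j; rewrite !mxE.
have [-> ->] := psd_polarE i j psdA.
by apply/eqP; rewrite eq_complex /= mulNr !eqxx.
Qed.

Lemma psd0 n : psd (0 : 'M[C]_n).
Proof. by move=> v; rewrite mulmx0 mul0mx mxE. Qed.

Lemma psdD n (A B : 'M[C]_n) : psd A -> psd B -> psd (A + B).
Proof. by move=> a b v; rewrite mulmxDr mulmxDl mxE addr_ge0. Qed.

Lemma psd_sum n (I : Type) (r : seq I) (F : I -> 'M[C]_n) :
  (forall i, psd (F i)) -> psd (\sum_(i <- r) F i).
Proof. by move=> h; elim/big_ind: _ => //; [exact: psd0 | exact: psdD]. Qed.

Lemma psdZ n c (A : 'M[C]_n) : 0 <= c -> psd A -> psd (c *: A).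
Proof. by move=> c0 a v; rewrite -scalemxAr -scalemxAl mxE mulr_ge0. Qed.

Lemma psd_conj m n (K : 'M[C]_(m, n)) (A : 'M[C]_m) : psd A -> psd (adj K *m A *m K).
Proof. by move=> a v; have := a (K *m v); rewrite adjM !mulmxA. Qed.

Lemma psd_gram m n (K : 'M[C]_(m, n)) : psd (adj K *m K).
Proof.
move=> v; rewrite mulmxA -adjM -mulmxA mxE sumr_ge0 // => i _.
by rewrite !mxE mulrC -normCK exprn_ge0.
Qed.

Lemma psd1 n : psd (1%:M : 'M[C]_n).
Proof.
by have := psd_gram (1%:M : 'M[C]_n); rewrite mulmx1 /adj map_mx1 trmx1.
Qed.

Lemma psd_tr_ge0 n (A : 'M[C]_n) : psd A -> 0 <= \tr A.
Proof. by move=> a; rewrite sumr_ge0 // => i _; apply: psd_diag. Qed.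

Lemma psd_diag_le_tr n (A : 'M[C]_n) i : psd A -> A i i <= \tr A.
Proof.
move=> a; rewrite /mxtrace (bigD1 i) //= lerDl sumr_ge0 // => j _.
exact: psd_diag.
Qed.

(** Spectral theorem: a PSD matrix is Hermitian, hence normal, and its eigenvalues are diagonal
    entries of the PSD matrix [S *m A *m adj S]. This reduces later claims to rank-one operators. *)
Lemma psd_decomposition n (A : 'M[C]_n) : psd A ->
  exists (d : 'I_n -> C) (v : 'I_n -> 'cV[C]_n),
    (forall i, 0 <= d i) /\ A = \sum_i d i *: (v i *m adj (v i)).
Proof.
move=> psdA.
have /orthomx_spectralP AE : A \is normalmx.
  apply/normalmxP; suff -> : (map_mx Num.conj A^T) = A by [].
  by rewrite -map_trmx -[RHS](psd_adj psdA).
set S := spectralmx A in AE; set D := spectral_diag A in AE.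
have uS : S \is unitarymx by apply: spectral_unitarymx.
have invS : invmx S = adj S.
  by rewrite invmx_unitary //; apply/matrixP=> i j; rewrite !mxE.
have DE : diag_mx D = S *m A *m adj S.
  rewrite AE -invS !mulmxA mulmxV ?unitarymx_unit // mul1mx -mulmxA.
  by rewrite mulmxV ?unitarymx_unit // mulmx1.
exists (fun i => D 0 i), (fun i => adj S *m delta_mx i 0); split=> [i|].
  have := psd_diag i (psd_conj (adj S) psdA).
  by rewrite adjK -DE mxE eqxx mulr1n.
rewrite {1}AE invS diag_mx_sum_delta mulmx_sumr mulmx_suml.
apply: eq_bigr => i _; rewrite adjM adjK adj_delta -!scalemxAr -scalemxAl.
by rewrite !mulmxA -[in RHS](mulmxA (adj S)) mul_delta_mx.
Qed.

Lemma psd_tr_mul n (A B : 'M[C]_n) : psd A -> psd B -> 0 <= \tr (A *m B).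
Proof.
move=> psdA /psd_decomposition[d [v [d0 ->]]].
rewrite mulmx_sumr raddf_sum sumr_ge0 //= => i _.
rewrite -scalemxAr linearZ /= mulr_ge0 // mulmxA mxtrace_mulC mulmxA.
by rewrite trace_mx11; apply: psdA.
Qed.

Lemma lowner_tr n (A B X : 'M[C]_n) : lowner A B -> psd X -> \tr (A *m X) <= \tr (B *m X).
Proof.
by move=> AB psdX; rewrite -subr_ge0 -linearB -mulmxBl psd_tr_mul.
Qed.

(** Testing on the rank-one operators [v *m adj v] recovers the quadratic form. Together with
    [lowner_tr], this turns the Löwner order into a comparison of traces. *)
Lemma tr_lowner n (A B : 'M[C]_n) :
  (forall X, psd X -> \tr (A *m X) <= \tr (B *m X)) -> lowner A B.
Proof.
move=> h v; have psdX : psd (v *m adj v) by rewrite -{1}[v]adjK; apply: psd_gram.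
have := h _ psdX; rewrite -subr_ge0 -linearB -mulmxBl /=.
by rewrite mulmxA mxtrace_mulC mulmxA trace_mx11.
Qed.

Lemma partial_tr_lowner n (A B : 'M[C]_n) :
  (forall X, partial_state X -> \tr (A *m X) <= \tr (B *m X)) -> lowner A B.
Proof.
move=> h; apply: tr_lowner => X psdX; have t0 := psd_tr_ge0 psdX.
have t1 : 0 < 1 + \tr X by rewrite ltr_wpDr.
(* Dividing by [1 + \tr X] rather than [\tr X] also covers trace zero. *)
have /h : partial_state ((1 + \tr X)^-1 *: X).
  split; first by apply: psdZ => //; rewrite invr_ge0 ltW.
  by rewrite linearZ /= mulrC ler_pdivrMr // mul1r lerDr.
by rewrite -!scalemxAr !linearZ /= ler_pM2l // invr_gt0.
Qed.

Lemma is_predE n (W : 'M[C]_n) :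
  is_pred W <-> forall X, psd X -> 0 <= \tr (W *m X) <= \tr X.
Proof.
split=> [[W0 W1] X psdX | h].
  have := lowner_tr W0 psdX; have := lowner_tr W1 psdX.
  by rewrite mul0mx mul1mx linear0 => -> ->.
by split; apply: tr_lowner => X /h /andP[h0 h1]; rewrite ?mul0mx ?mul1mx ?linear0.
Qed.

Lemma pred_psd n (W : 'M[C]_n) : is_pred W -> psd W.
Proof. by case; rewrite /lowner subr0. Qed.

Lemma pred_zero n : is_pred (0 : 'M[C]_n).
Proof. by rewrite /is_pred /lowner !subr0; split; [exact: psd0 | exact: psd1]. Qed.

Lemma pred_compl n (W : 'M[C]_n) : is_pred W -> is_pred (1%:M - W).
Proof. by rewrite /is_pred /lowner subr0 subKr => -[]; rewrite subr0. Qed.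

Lemma lowner_refl n (A : 'M[C]_n) : lowner A A.
Proof. by rewrite /lowner subrr; apply: psd0. Qed.
End Matrices.

(** * Entrywise convergence *)

Section Convergence.
Variable R : realType.
Local Notation C := (R[i]).

(** Stated componentwise so that [op_cvg] is, by definition, [ccvg] of every entry. *)
Definition ccvg (u : nat -> C) (l : C) : Prop :=
  ((fun k => complex.Re (u k)) @ \oo --> complex.Re l) /\
  ((fun k => complex.Im (u k)) @ \oo --> complex.Im l).

Lemma ReD (x y : C) : complex.Re (x + y) = complex.Re x + complex.Re y.
Proof. by case: x; case: y. Qed.

Lemma ImD (x y : C) : complex.Im (x + y) = complex.Im x + complex.Im y.
Proof. by case: x; case: y. Qed.

Lemma ReM (x y : C) : complex.Re (x * y) =
  complex.Re x * complex.Re y - complex.Im x * complex.Im y.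
Proof. by case: x; case: y. Qed.

Lemma ImM (x y : C) : complex.Im (x * y) =
  complex.Re x * complex.Im y + complex.Im x * complex.Re y.
Proof. by case: x; case: y. Qed.

Lemma ccvg_cst l : ccvg (fun=> l) l.
Proof. by split; apply: cvg_cst. Qed.

Lemma ccvgD u v a b : ccvg u a -> ccvg v b -> ccvg (fun n => u n + v n) (a + b).
Proof.
move=> [ua ua'] [vb vb']; split.
  rewrite ReD; under eq_fun do rewrite ReD; exact: cvgD.
by rewrite ImD; under eq_fun do rewrite ImD; apply: cvgD.
Qed.

Lemma ccvgMl c u a : ccvg u a -> ccvg (fun n => c * u n) (c * a).
Proof.
move=> [ua ua']; split.
  rewrite ReM; under eq_fun do rewrite ReM; apply: cvgB; exact: cvgMr.
by rewrite ImM; under eq_fun do rewrite ImM; apply: cvgD; apply: cvgMr.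
Qed.

Lemma ccvg_sum (I : Type) (r : seq I) (u : I -> nat -> C) (a : I -> C) :
  (forall i, ccvg (u i) (a i)) ->
  ccvg (fun n => \sum_(i <- r) u i n) (\sum_(i <- r) a i).
Proof.
move=> h; elim: r => [|i r IH].
  by rewrite big_nil; under eq_fun do rewrite big_nil; apply: ccvg_cst.
by rewrite big_cons; under eq_fun do rewrite big_cons; apply: ccvgD.
Qed.

(** Comparable complex numbers have equal imaginary parts, so the imaginary parts of [u] are
    constantly that of [c]; the real parts obey the usual limit inequality. *)
Lemma ccvg_ge c u a : ccvg u a -> (forall n, c <= u n) -> c <= a.
Proof.
move=> [ua ua'] h; rewrite lecE; apply/andP; split.
  apply/eqP/(cvg_unique _ ua'); first exact: norm_hausdorff.
  suff -> : (fun k => complex.Im (u k)) = fun=> complex.Im c by apply: cvg_cst.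
  by apply/funext=> k; have := h k; rewrite lecE => /andP[/eqP].
rewrite -(cvg_lim _ ua); last exact: norm_hausdorff.
apply: limr_ge; first by apply/cvg_ex; exists (complex.Re a).
by apply: nearW => k; have := h k; rewrite lecE => /andP[].
Qed.

Lemma ccvgN u a : ccvg u a -> ccvg (fun n => - u n) (- a).
Proof.
by move=> /(ccvgMl (-1)); rewrite mulN1r; under eq_fun do rewrite mulN1r.
Qed.

Lemma ccvg_le c u a : ccvg u a -> (forall n, u n <= c) -> a <= c.
Proof.
move=> /ccvgN h uc; rewrite -lerN2; apply: (ccvg_ge h) => n.
by rewrite lerN2.
Qed.

Lemma ccvg_shift u a : ccvg u a -> ccvg (fun n => u n.+1) a.
Proof. by move=> [ua ua']; split; [move: ua | move: ua']; rewrite -cvg_shiftS. Qed.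

Lemma ccvg_unique u a b : ccvg u a -> ccvg u b -> a = b.
Proof.
move=> [ua ua'] [ub ub']; apply/eqP; rewrite eq_complex.
apply/andP; split; apply/eqP.
  by apply: (cvg_unique _ ua ub); exact: norm_hausdorff.
by apply: (cvg_unique _ ua' ub'); exact: norm_hausdorff.
Qed.

Lemma op_cvg_tr n (f : nat -> 'M[C]_n) L A :
  op_cvg f L -> ccvg (fun k => \tr (A *m f k)) (\tr (A *m L)).
Proof.
move=> h; have trE B : \tr (A *m B) = \sum_i \sum_j A i j * B j i.
  by apply: eq_bigr => i _; rewrite mxE.
rewrite trE; under eq_fun do rewrite trE.
by do 2!apply: ccvg_sum => ?; apply: ccvgMl; apply: h.
Qed.

Lemma op_cvg_psd n (f : nat -> 'M[C]_n) L :
  op_cvg f L -> (forall k, psd (f k)) -> psd L.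
Proof.
move=> h fp; rewrite -[L]subr0; apply: tr_lowner => X psdX.
rewrite mul0mx linear0 mxtrace_mulC; apply: (ccvg_ge (op_cvg_tr X h)) => k.
exact: psd_tr_mul.
Qed.

Lemma op_cvg_series n (f : nat -> 'M[C]_n) L :
  op_cvg (fun k => \sum_(m < k) f m) L -> op_series f = L.
Proof.
move=> h; apply/matrixP => i j; have [h1 h2] := h i j; rewrite mxE.
apply/eqP; rewrite eq_complex /=.
by apply/andP; split; apply/eqP; apply: cvg_lim => //; exact: norm_hausdorff.
Qed.

(** Parallelogram law: the forms at [c] and [- c] add up to twice [A i i + A j j]; the second is
    nonnegative and each diagonal entry is at most the trace. *)
Lemma sesq_polar_le n (A : 'M[C]_n) i j c : psd A -> Num.conj c * c = 1 ->
  sesq A (polar_vec i j c) (polar_vec i j c) <= \tr A *+ 4.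
Proof.
move=> psdA c1.
have h : 0 <= sesq A (polar_vec i j (- c)) (polar_vec i j (- c)) by apply: psdA.
have -> : sesq A (polar_vec i j c) (polar_vec i j c) = A i i *+ 2 + A j j *+ 2 -
   sesq A (polar_vec i j (- c)) (polar_vec i j (- c)).
  by rewrite !sesq_polar rmorphN mulrNN c1; ring.
rewrite lerBlDr ler_wpDr // (mulrnDr _ 2 2) lerD // ler_wMn2r //;
  exact: psd_diag_le_tr.
Qed.

Lemma sesqB n (A B : 'M[C]_n) u v : sesq (A - B) u v = sesq A u v - sesq B u v.
Proof. by rewrite /sesq mulmxBr mulmxBl [LHS]mxE; congr (_ + _); rewrite mxE. Qed.

Lemma sesq_polar_cvg n (f : nat -> 'M[C]_n) (c : C) i j b :
  (forall k, psd (f k)) -> (forall k, lowner (f k) (f k.+1)) ->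
  (forall k, \tr (f k) <= c) -> Num.conj b * b = 1 ->
  cvgn (fun k => complex.Re (sesq (f k) (polar_vec i j b) (polar_vec i j b))).
Proof.
move=> fpsd fmono fbd b1; apply: nondecreasing_is_cvgn.
  apply/nondecreasing_seqP => k; have := fmono k (polar_vec i j b).
  by rewrite -/(sesq _ _ _) sesqB subr_ge0 lecE => /andP[].
exists (complex.Re (c *+ 4)) => _ [k _ <-].
have : sesq (f k) (polar_vec i j b) (polar_vec i j b) <= c *+ 4.
  by apply: le_trans (sesq_polar_le _ _ (fpsd k) b1) _; rewrite ler_wMn2r.
by rewrite lecE => /andP[].
Qed.

(** By polarization every entry is a fixed real-linear combination of quadratic forms of [f k], and
    these are nondecreasing and bounded through the trace. *)
Lemma monotone_op_cvg n (f : nat -> 'M[C]_n) (c : C) :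
  (forall k, psd (f k)) -> (forall k, lowner (f k) (f k.+1)) ->
  (forall k, \tr (f k) <= c) -> exists L, op_cvg f L.
Proof.
move=> fpsd fmono fbd.
pose L : 'M[C]_n := \matrix_(i, j) Complex (limn (fun k => complex.Re (f k i j)))
   (limn (fun k => complex.Im (f k i j))).
have dcvg i : cvgn (fun k => complex.Re (f k i i)).
  apply: nondecreasing_is_cvgn.
    apply/nondecreasing_seqP => k; have := psd_diag i (fmono k).
    by rewrite !mxE subr_ge0 lecE => /andP[].
  exists (complex.Re c) => _ [k _ <-].
  by have := le_trans (psd_diag_le_tr i (fpsd k)) (fbd k); rewrite lecE => /andP[].
have i1 : Num.conj 'i%C * 'i%C = 1 :> C.
  by rewrite conj_i mulNr -expr2 sqr_i opprK.
have c1 : Num.conj 1 * 1 = 1 :> C by rewrite rmorph1 mulr1.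
exists L => i j; rewrite mxE /=; split.
  under eq_fun do rewrite (psd_polarE i j (fpsd _)).1 /=.
  apply: is_cvgMl; apply: is_cvgB; last exact: is_cvgD.
  exact: (sesq_polar_cvg fpsd fmono fbd c1).
under eq_fun do rewrite (psd_polarE i j (fpsd _)).1 /=.
apply: is_cvgMl; apply: is_cvgN; apply: is_cvgB; last exact: is_cvgD.
exact: (sesq_polar_cvg fpsd fmono fbd i1).
Qed.

End Convergence.

(** * Cylindrical extension *)

Section Lift.
Variable R : realType.
Local Notation C := (R[i]).
Variable V : finType.
Variable Sig : V -> finType.
Variable zero : forall q, Sig q.
Variable qs : {set V}.
Local Notation Bas := (Bas Sig).
Local Notation LBas := (LBas Sig qs).
Local Notation lift := (@Defs.lift R V Sig qs).
Local Notation rk := enum_rank.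

Lemma op_ext (T : finType) (A B : op R T) :
  (forall x y, A (rk x) (rk y) = B (rk x) (rk y)) -> A = B.
Proof. by move=> h; apply/matrixP=> i j; rewrite -(enum_valK i) -(enum_valK j) h. Qed.

Lemma op_mulE (T : finType) (A B : op R T) x y :
  (A *m B) (rk x) (rk y) = \sum_z A (rk x) (rk z) * B (rk z) (rk y).
Proof. by rewrite mxE (reindex rk) //; apply: onW_bij; apply: enum_rank_bij. Qed.

Definition agree_off (x y : Bas) : bool := [forall q : V, (q \notin qs) ==> (x q == y q)].

(** Overwrites [x] on [qs] by [b]. The match on [idP] supplies the membership proof that [b] takes
    as part of its argument. *)
Definition glue (x : Bas) (b : LBas) : Bas :=
  @finfun V Sig (fun q => match @idP (q \in qs) with
    | ReflectT h => b (exist _ q h)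
    | ReflectF _ => x q end).

Lemma restr_glue x b : restr qs (glue x b) = b.
Proof.
apply/ffunP => -[q h]; rewrite !ffunE /=.
by case: {-}_ / idP => [h'|//]; rewrite (bool_irrelevance h h').
Qed.

Lemma agree_glue x b : agree_off x (glue x b).
Proof.
apply/forallP => q; apply/implyP => qF; rewrite ffunE.
by case: {-}_ / idP => // h; rewrite h in qF.
Qed.

Lemma glue_restr x y : agree_off x y -> glue x (restr qs y) = y.
Proof.
move=> /forallP xy; apply/ffunP => q; rewrite ffunE.
case: {-}_ / idP => [h|/negP h]; first by rewrite ffunE.
by have := xy q; rewrite h => /eqP.
Qed.

Lemma agree_off_sym x y : agree_off x y = agree_off y x.
Proof. by apply: eq_forallb => q; rewrite eq_sym. Qed.

Lemma agree_off_trans x y z : agree_off x y -> agree_off y z = agree_off x z.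
Proof.
move=> /forallP xy; apply: eq_forallb => q.
by have := xy q; case: (q \in qs) => //= /eqP->.
Qed.

Lemma liftE (A : op R LBas) x y :
  lift A (rk x) (rk y) = A (rk (restr qs x)) (rk (restr qs y)) * (agree_off x y)%:R.
Proof. by rewrite mxE !enum_rankK. Qed.

Lemma lift1 : lift 1%:M = 1%:M.
Proof.
apply: op_ext => x y; rewrite liftE !mxE -natrM mulnb; congr (_ %:R).
rewrite !(can_eq (@enum_rankK _)); congr nat_of_bool.
apply/andP/eqP => [[/eqP rxy xy]|->].
  by rewrite -(glue_restr xy) -rxy glue_restr // /agree_off; apply/forallP => q; rewrite eqxx implybT.
by rewrite eqxx; split=> //; apply/forallP => q; rewrite eqxx implybT.
Qed.

Lemma liftD A B : lift (A + B) = lift A + lift B.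
Proof. by apply: op_ext => x y; rewrite !(liftE, mxE) mulrDl. Qed.

Lemma liftZ c A : lift (c *: A) = c *: lift A.
Proof. by apply: op_ext => x y; rewrite !(liftE, mxE) mulrA. Qed.

Lemma lift0 : lift 0 = 0.
Proof. by apply: op_ext => x y; rewrite !(liftE, mxE) mul0r. Qed.

Lemma lift_sum (I : Type) (r : seq I) F :
  lift (\sum_(i <- r) F i) = \sum_(i <- r) lift (F i).
Proof. by elim/big_rec2: _ => [|i y x _ <-]; [exact: lift0 | exact: liftD]. Qed.

Lemma lift_adj A : adj (lift A) = lift (adj A).
Proof.
apply: op_ext => x y; rewrite liftE !adjE liftE rmorphM rmorph_nat.
by rewrite agree_off_sym.
Qed.

Lemma liftM A B : lift A *m lift B = lift (A *m B).
Proof.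
apply: op_ext => x z; rewrite op_mulE liftE op_mulE mulr_suml.
transitivity (\sum_(y | agree_off x y) A (rk (restr qs x)) (rk (restr qs y)) *
   B (rk (restr qs y)) (rk (restr qs z)) * (agree_off x z)%:R).
  rewrite [RHS]big_mkcond; apply: eq_bigr => y _; rewrite !liftE.
  case: ifP => xy; last by rewrite mulr0 mul0r.
  by rewrite mulr1 (agree_off_trans _ xy) mulrA.
(* The assignments agreeing with [x] off [qs] are exactly the [glue x b], so the sum becomes the
   local matrix product. *)
rewrite (reindex (glue x)) /=; last first.
  exists (restr qs) => y; first by rewrite restr_glue.
  exact: glue_restr.
by apply: eq_big => b; rewrite ?agree_glue // restr_glue.
Qed.

Lemma lift_psd A : psd A -> psd (lift A).
Proof.
move=> /psd_decomposition[d [v [d0 ->]]]; rewrite lift_sum; apply: psd_sum => i.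
rewrite liftZ; apply: psdZ => //.
(* The column [v i] is padded to a square matrix, to which [lift] applies; the lifted term then has
   the form K K*. *)
have -> : v i *m adj (v i) = v i *m delta_mx (0 : 'I_1) i *m adj (v i *m delta_mx (0 : 'I_1) i).
  have d1 : delta_mx 0 0 = 1%:M :> 'M[C]_1 by rewrite [LHS]mx11_scalar mxE.
  by rewrite adjM adj_delta mulmxA -[v i *m _ *m _]mulmxA mul_delta_mx d1 mulmx1.
rewrite -liftM -lift_adj -{1}[lift _]adjK; exact: psd_gram.
Qed.

Lemma lift_unitary U : unitary U ->
  adj (lift U) *m lift U = 1%:M /\ lift U *m adj (lift U) = 1%:M.
Proof. by move=> [h1 h2]; rewrite lift_adj !liftM h1 h2 lift1. Qed.

Lemma adj_ketbra (a b : LBas) : adj (ketbra R a b) = ketbra R b a.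
Proof. exact: adj_delta. Qed.

(** Completeness relation of the Kraus operators |0><x| of initialization, which yields its trace
    bound. *)
Lemma init_kraus_complete :
  \sum_(x : LBas) lift (ketbra R x (lzero zero qs)) *m lift (ketbra R (lzero zero qs) x) = 1%:M.
Proof.
under eq_bigr do rewrite liftM /ketbra mul_delta_mx.
rewrite -lift_sum -lift1; congr Defs.lift.
rewrite -diag_const_mx diag_mx_sum_delta (reindex rk) /=.
  by apply: eq_bigr => x _; rewrite mxE scale1r.
by apply: onW_bij; apply: enum_rank_bij.
Qed.
End Lift.

(** * Weakest preconditions by trace duality *)

Section Transformers.
Variable R : realType.
Local Notation C := (R[i]).
Variable n : nat.
Implicit Types (F G : 'M[C]_n -> 'M[C]_n) (P Q W X : 'M[C]_n).

Definition psd_tr_nonincreasing F :=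
  forall X, psd X -> psd (F X) /\ \tr (F X) <= \tr X.

Definition dual_at F Q W := forall X, psd X -> \tr (Q *m F X) = \tr (W *m X).

(** Abstracts a positive, trace-nonincreasing map. Linearity enters only through the existence of
    trace duals, and everything is tested on PSD inputs, where the loop series is shown to
    converge. *)
Record transformer F : Prop := Transformer {
  transformerP : psd_tr_nonincreasing F;
  transformer_dual : forall Q, is_pred Q -> exists W, dual_at F Q W }.

(** Picks a dual operator, with default 0 if there is none; [wpP] is the property used. *)
Definition wp F Q : 'M[C]_n := xget 0 [set W | dual_at F Q W].

Lemma wpP F Q : transformer F -> is_pred Q -> dual_at F Q (wp F Q).
Proof. by move=> tF Qp; apply: (xgetPex 0 (transformer_dual tF Qp)). Qed.

Lemma transformer_psd F X : transformer F -> psd X -> psd (F X).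
Proof. by move=> tF /(transformerP tF)[]. Qed.

Lemma transformer_tr F X : transformer F -> psd X -> \tr (F X) <= \tr X.
Proof. by move=> tF /(transformerP tF)[]. Qed.

Lemma dual_pred F Q W : transformer F -> is_pred Q -> dual_at F Q W -> is_pred W.
Proof.
move=> tF Qp QW; apply/is_predE => X psdX; rewrite -QW //.
have /andP[-> h] := (is_predE Q).1 Qp _ (transformer_psd tF psdX).
exact: le_trans h (transformer_tr tF psdX).
Qed.

Lemma wp_pred F Q : transformer F -> is_pred Q -> is_pred (wp F Q).
Proof. by move=> tF Qp; apply: (dual_pred tF Qp (wpP tF Qp)). Qed.

Lemma wp_mono F Q Q' : transformer F -> is_pred Q -> is_pred Q' ->
  lowner Q Q' -> lowner (wp F Q) (wp F Q').
Proof.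
move=> tF Qp Qp' QQ'; apply: tr_lowner => X psdX.
rewrite -(wpP tF Qp) // -(wpP tF Qp') //.
exact: lowner_tr QQ' (transformer_psd tF psdX).
Qed.

Definition triple P F Q := forall X, psd X -> \tr (P *m X) <= \tr (Q *m F X).

(** Turns a valid triple into the Löwner side condition of a refinement rule, once a dual is
    known. *)
Lemma triple_dual P F Q W : dual_at F Q W -> triple P F Q -> lowner P W.
Proof. by move=> QW h; apply: tr_lowner => X psdX; rewrite -QW //; apply: h. Qed.

Lemma transformer_id : transformer id.
Proof. by split=> [X psdX|Q Qp]; [split | exists Q]. Qed.

Lemma transformer_comp F G : transformer F -> transformer G -> transformer (fun X => G (F X)).
Proof.
move=> tF tG; split=> [X psdX|Q Qp].
  have psdF := transformer_psd tF psdX; split; first exact: transformer_psd.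
  exact: le_trans (transformer_tr tG psdF) (transformer_tr tF psdX).
exists (wp F (wp G Q)) => X psdX.
by rewrite (wpP tG) ?(wpP tF) //; [apply: wp_pred | apply: transformer_psd].
Qed.

Lemma transformer_iter F N : transformer F -> transformer (iter N F).
Proof.
by move=> tF; elim: N => [|N IH]; [exact: transformer_id | exact: transformer_comp].
Qed.

Lemma sqrtm_psd (A : 'M[C]_n) : psd (sqrtm A).
Proof.
rewrite /sqrtm; case: pselect => [h|_]; last exact: psd0.
by case: (cid h) => Y [].
Qed.

(* If [A] had no square root, [sqrtm A] would be the junk value [0]; the
   inequality holds in both cases, and it is all that is needed. *)
Lemma sqrtm_sqr_le (A : 'M[C]_n) : psd A -> lowner (sqrtm A *m sqrtm A) A.
Proof.
rewrite /sqrtm; case: pselect => [h|_ psdA]; last by rewrite /lowner mul0mx subr0.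
by case: (cid h) => Y [_ /= ->] _; apply: lowner_refl.
Qed.

End Transformers.

(** * Program constructs as transformers *)

Section Semantics.
Variable R : realType.
Local Notation C := (R[i]).
Variable V : finType.
Variable Sig : V -> finType.
Variable zero : forall q, Sig q.
Local Notation Bas := (Bas Sig).
Local Notation LBas := (LBas Sig).
Local Notation op := (op R).
Local Notation lift := Defs.lift.

Section Measurements.
Variable qs : {set V}.
Implicit Types (M B : op (LBas qs)) (X Q : op Bas).

Lemma Mmap_psd M X : psd X -> psd (Mmap M X).
Proof. by move=> psdX; rewrite /Mmap -{1}(psd_adj (sqrtm_psd (lift M))); apply: psd_conj. Qed.

(** Measurement maps are self-dual for the trace pairing, by cyclicity. *)
Lemma tr_Mmap M Q X : \tr (Q *m Mmap M X) = \tr (Mmap M Q *m X).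
Proof. by rewrite /Mmap mulmxA mxtrace_mulC !mulmxA. Qed.

Lemma tr_Mmap_le M X : psd M -> psd X -> \tr (Mmap M X) <= \tr (lift M *m X).
Proof.
move=> psdM psdX; rewrite -[Mmap M X]mul1mx tr_Mmap /Mmap mulmx1.
by apply: lowner_tr => //; apply/sqrtm_sqr_le/lift_psd.
Qed.

Lemma tr_measurement_le m (M : 'I_m -> op (LBas qs)) X : measurement M -> psd X ->
  \sum_w \tr (Mmap (M w) X) <= \tr X.
Proof.
move=> [psdM M1] psdX; rewrite -[in leRHS](mul1mx X) -(@lift1 R V Sig qs) -M1.
rewrite lift_sum mulmx_suml raddf_sum /=; apply: ler_sum => w _.
exact: tr_Mmap_le.
Qed.

Lemma tr_binary_le B X : is_pred B -> psd X ->
  \tr (B0map B X) + \tr (B1map B X) <= \tr X.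
Proof.
move=> Bp psdX; rewrite -[in leRHS](mul1mx X) -(@lift1 R V Sig qs).
rewrite -[1%:M](subrK B) liftD mulmxDl linearD /=.
by apply: lerD; apply: tr_Mmap_le => //; apply: pred_psd => //; apply: pred_compl.
Qed.

Lemma tr_binary_dual B Q W X :
  \tr ((B0map B Q + B1map B W) *m X) = \tr (Q *m B0map B X) + \tr (W *m B1map B X).
Proof. by rewrite mulmxDl linearD /= -!tr_Mmap. Qed.

Lemma binary_pred B Q W : is_pred B -> is_pred Q -> is_pred W ->
  is_pred (B0map B Q + B1map B W).
Proof.
move=> Bp Qp Wp; apply/is_predE => X psdX; rewrite tr_binary_dual.
have /andP[q0 q1] := (is_predE Q).1 Qp _ (Mmap_psd (1%:M - B) psdX).
have /andP[w0 w1] := (is_predE W).1 Wp _ (Mmap_psd B psdX).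
rewrite addr_ge0 //=; apply: le_trans (tr_binary_le Bp psdX); exact: lerD.
Qed.

Lemma binary_mono B Q W W' : lowner W W' ->
  lowner (B0map B Q + B1map B W) (B0map B Q + B1map B W').
Proof.
move=> WW'; apply: tr_lowner => X psdX; rewrite !tr_binary_dual lerD2l.
exact: lowner_tr WW' (Mmap_psd B psdX).
Qed.

End Measurements.

(** * Loops: convergence of the series and its dual *)

Section While.
Variables (qs : {set V}) (B : op (LBas qs)) (F : op Bas -> op Bas).
Hypothesis Bp : is_pred B.
Hypothesis tF : transformer F.

(** The summand in the semantics of a loop, with the denotation of the body abstracted to [F]. *)
Definition while_term (X : op Bas) (k : nat) := B0map B (iter k (fun Y => F (B1map B Y)) X).
Definition while_partial k (X : op Bas) := \sum_(m < k) while_term X m.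

Lemma while_partialS k X :
  while_partial k.+1 X = B0map B X + while_partial k (F (B1map B X)).
Proof.
rewrite /while_partial big_ord_recl /=; congr (_ + _).
by apply: eq_bigr => m _; rewrite /while_term -iterSr.
Qed.

Lemma body_psd X : psd X -> psd (F (B1map B X)).
Proof. by move=> psdX; apply: transformer_psd => //; apply: Mmap_psd. Qed.

Lemma while_term_psd X k : psd X -> psd (while_term X k).
Proof.
move=> psdX; apply: Mmap_psd; elim: k => //= k; exact: body_psd.
Qed.

Lemma while_partial_psd k X : psd X -> psd (while_partial k X).
Proof. by move=> psdX; apply: psd_sum => m; apply: while_term_psd. Qed.

Lemma while_partial_mono k X : psd X -> lowner (while_partial k X) (while_partial k.+1 X).
Proof.
move=> psdX; rewrite /lowner /while_partial big_ord_recr /= addrAC subrr add0r.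
exact: while_term_psd.
Qed.

(** Induction by peeling off the first iteration: the remaining terms have trace at most that of
    [B1map B X], and the two measurement branches together have trace at most [\tr X]. *)
Lemma while_partial_tr k X : psd X -> \tr (while_partial k X) <= \tr X.
Proof.
elim: k X => [|k IH] X psdX.
  by rewrite /while_partial big_ord0 linear0 psd_tr_ge0.
rewrite while_partialS linearD; apply: le_trans (tr_binary_le Bp psdX).
rewrite lerD2l; apply: le_trans (IH _ (body_psd psdX)) _.
exact/(transformer_tr tF)/Mmap_psd.
Qed.

Definition while_sem X := op_series (while_term X).

Lemma while_sem_cvg X : psd X -> op_cvg (fun k => while_partial k X) (while_sem X).
Proof.
move=> psdX; have [L hL] := monotone_op_cvg (fun k => while_partial_psd k psdX)
  (fun k => while_partial_mono k psdX) (fun k => while_partial_tr k psdX).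
by rewrite /while_sem (op_cvg_series hL).
Qed.

Section Invariant.
Variable Q : op Bas.
Hypothesis Qp : is_pred Q.

(** The [k]-th operator is dual to one pass of the body followed by the first [k] terms of the loop
    series. *)
Definition loop_invariant k : op Bas := iter k (fun W => wp F (B0map B Q + B1map B W)) 0.

Lemma loop_invariant_pred k : is_pred (loop_invariant k).
Proof.
elim: k => [|k IH]; first exact: pred_zero.
by apply: wp_pred => //; apply: binary_pred.
Qed.

Lemma loop_invariant_mono k : lowner (loop_invariant k) (loop_invariant k.+1).
Proof.
elim: k => [|k IH]; first by have [] := loop_invariant_pred 1.
apply: wp_mono => //; last exact: binary_mono.
  by apply: binary_pred => //; apply: loop_invariant_pred.
by apply: binary_pred => //; apply: (loop_invariant_pred k.+1).
Qed.

Definition loop_invariant_lim : op Bas := xget 0 [set L | op_cvg loop_invariant L].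

Lemma loop_invariant_cvg : op_cvg loop_invariant loop_invariant_lim.
Proof.
apply: (@xgetPex _ 0 [set L | op_cvg loop_invariant L]).
apply: (@monotone_op_cvg _ _ _ (\tr (1%:M : op Bas))) => k.
- exact/pred_psd/loop_invariant_pred.
- exact: loop_invariant_mono.
(* A predicate tested on the identity has trace at most that of the identity. *)
- rewrite -[loop_invariant k]mulmx1.
  by case/andP: ((is_predE _).1 (loop_invariant_pred k) _ (@psd1 _ _)).
Qed.

(** The index shift comes from the exit branch: [B0map B Q] accounts for term 0, and
    [loop_invariant k] for the next [k] terms, started after one pass of the body. *)
Lemma while_partial_dual k X : psd X ->
  \tr (Q *m while_partial k.+1 X) = \tr ((B0map B Q + B1map B (loop_invariant k)) *m X).
Proof.
elim: k X => [|k IH] X psdX; rewrite tr_binary_dual while_partialS mulmxDr linearD /=.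
  by rewrite /while_partial big_ord0 mulmx0 mul0mx !linear0.
congr (_ + _); rewrite IH; last exact: body_psd.
rewrite wpP //; last exact: Mmap_psd.
by apply: binary_pred => //; apply: loop_invariant_pred.
Qed.

(** Both sides of [while_partial_dual] converge, and limits are unique. *)
Lemma while_dual : dual_at while_sem Q (B0map B Q + B1map B loop_invariant_lim).
Proof.
move=> X psdX.
have h1 := ccvg_shift (op_cvg_tr Q (while_sem_cvg psdX)).
apply: (ccvg_unique h1).
rewrite tr_binary_dual; under eq_fun do rewrite while_partial_dual // tr_binary_dual.
apply: ccvgD; first exact: ccvg_cst.
rewrite mxtrace_mulC; under eq_fun do rewrite mxtrace_mulC.
exact: (op_cvg_tr _ loop_invariant_cvg).
Qed.
End Invariant.

Lemma while_transformer : transformer while_sem.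
Proof.
split=> [X psdX|Q Qp]; last by exists (B0map B Q + B1map B (loop_invariant_lim Q)); apply: while_dual.
have cv := while_sem_cvg psdX; split.
  by apply: (op_cvg_psd cv) => k; apply: while_partial_psd.
rewrite -[while_sem X]mul1mx; apply: (ccvg_le (op_cvg_tr 1%:M cv)) => k.
by rewrite mul1mx; apply: while_partial_tr.
Qed.
End While.

(** * Initialization, unitaries, case, and whole programs *)

Lemma init_dual qs (Q : op Bas) : dual_at (@init_map R V Sig zero qs) Q (init_pre zero qs Q).
Proof.
move=> X _; rewrite /init_map /init_pre mulmx_sumr mulmx_suml !raddf_sum /=.
by apply: eq_bigr => x _; rewrite mulmxA mxtrace_mulC !mulmxA.
Qed.

Lemma init_transformer qs : transformer (@init_map R V Sig zero qs).
Proof.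
split=> [X psdX|Q _]; last by exists (init_pre zero qs Q); apply: init_dual.
split.
  apply: psd_sum => x; rewrite -[lift (ketbra _ (lzero _ _) x)]adjK.
  rewrite lift_adj adj_ketbra; exact: psd_conj.
(* The trace is the pairing with the identity, whose dual is the identity by completeness. *)
rewrite -[init_map _ _ _]mul1mx init_dual // /init_pre.
by under eq_bigr do rewrite mulmx1; rewrite init_kraus_complete mul1mx.
Qed.

Lemma unit_dual n (U Q : 'M[C]_n) : dual_at (fun X => U *m X *m adj U) Q (adj U *m Q *m U).
Proof. by move=> X _; rewrite mulmxA mxtrace_mulC !mulmxA. Qed.

Lemma unit_transformer n (U : 'M[C]_n) : adj U *m U = 1%:M ->
  transformer (fun X => U *m X *m adj U).
Proof.
move=> U1; split=> [X psdX|Q _]; last by exists (adj U *m Q *m U); apply: unit_dual.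
split; first by rewrite -{1}[U]adjK; apply: psd_conj.
by rewrite -[U *m X *m adj U]mul1mx unit_dual // mulmx1 U1 mul1mx.
Qed.

Section Case.
Variables (qs : {set V}) (m : nat) (M : 'I_m -> op (LBas qs)) (F : 'I_m -> op Bas -> op Bas).
Hypothesis tF : forall w, transformer (F w).

Lemma case_dual Q : is_pred Q -> dual_at (fun X => \sum_w F w (Mmap (M w) X)) Q
  (\sum_w Mmap (M w) (wp (F w) Q)).
Proof.
move=> Qp X psdX; rewrite mulmx_sumr mulmx_suml !raddf_sum /=.
by apply: eq_bigr => w _; rewrite wpP //; [rewrite tr_Mmap | apply: Mmap_psd].
Qed.

Lemma case_transformer : measurement M -> transformer (fun X => \sum_w F w (Mmap (M w) X)).
Proof.
move=> mM; split=> [X psdX|Q Qp]; last by eexists; apply: case_dual.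
split; first by apply: psd_sum => w; apply/transformer_psd/Mmap_psd.
rewrite raddf_sum; apply: le_trans (tr_measurement_le mM psdX).
by apply: ler_sum => w _; apply/transformer_tr/Mmap_psd.
Qed.
End Case.

Lemma sem_transformer (S : prog R Sig) : concrete S -> wf S -> transformer (sem zero S).
Proof.
elim: S => [|qs|qs U|S1 IH1 S2 IH2|N S1 IH|qs m M Ss IH|qs B S1 IH|] //=.
- by move=> _ _; apply: transformer_id.
- by move=> _ _; apply: init_transformer.
- by move=> _ /lift_unitary[U1 _]; apply: unit_transformer.
- move=> [c1 c2] [w1 w2]; exact: transformer_comp (IH1 c1 w1) (IH2 c2 w2).
- by move=> c w; apply: transformer_iter; apply: IH.
- by move=> c [mM w]; apply: (@case_transformer _ _ M (fun v => sem zero (Ss v))) => // v; apply: IH.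
- by move=> c [Bp w]; apply: while_transformer => //; apply: IH.
Qed.

End Semantics.

(** * Refinement *)

Section Refinement.
Variable R : realType.
Variable V : finType.
Variable Sig : V -> finType.
Variable zero : forall q, Sig q.
Local Notation prog := (prog R Sig).
Local Notation refines := (@refines_tot R V Sig zero).

Lemma refines_trans (S1 S2 S3 : prog) : refines S1 S2 -> refines S2 S3 -> refines S1 S3.
Proof. exact: rt_trans. Qed.

Lemma refines_congr (K : prog -> prog) :
  (forall S S', rstep_tot zero S S' -> rstep_tot zero (K S) (K S')) ->
  forall S S', refines S S' -> refines (K S) (K S').
Proof.
move=> h S S'; elim=> [x y /h|x|x y z _ h1 _ h2]; [exact: rt_step | exact: rt_refl |].
exact: rt_trans h1 h2.
Qed.

Lemma refines_seq (S1 S1' S2 S2' : prog) :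
  refines S1 S1' -> refines S2 S2' -> refines (Seq S1 S2) (Seq S1' S2').
Proof.
move=> h1 h2; apply: (@refines_trans _ (Seq S1' S2)).
  exact: (refines_congr (K := fun S => Seq S S2) (fun _ _ => @C_seqL _ _ _ _ _ _ _)).
exact: (refines_congr (K := fun S => Seq S1' S) (fun _ _ => @C_seqR _ _ _ _ _ _ _)).
Qed.

(** [C_case] replaces one branch at a time, so the branches are refined by induction on the list [r]
    of those already treated. *)
Lemma refines_case (qs : {set V}) m (M : 'I_m -> op R (LBas Sig qs)) (Ss Ts : 'I_m -> prog) :
  (forall w, refines (Ss w) (Ts w)) -> refines (Case M Ss) (Case M Ts).
Proof.
move=> h.
suff branches (r : seq 'I_m) :
    refines (Case M Ss) (Case M (fun v => if v \in r then Ts v else Ss v)).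
  have := branches (enum 'I_m); congr (refines _ (Case M _)).
  by apply/funext => v; rewrite mem_enum.
elim: r => [|w r IH]; first exact: rt_refl.
apply: (refines_trans IH); set Us := (fun v : 'I_m => if v \in r then _ else _).
have -> : (fun v => if v \in w :: r then Ts v else Ss v) =
          (fun v => if v == w then Ts w else Us v).
  by apply/funext => v; rewrite inE; case: eqP => [->|].
(* Source and target now differ only in the value put at [w], so both are instances of the context
   [K] below. *)
have {1}-> : Us = (fun v => if v == w then Us w else Us v).
  by apply/funext => v; case: eqP => [->|].
pose K S := Case M (fun v => if v == w then S else Us v).
apply: (refines_congr (K := K)); last first.
  by rewrite /Us; case: ifP => // _; apply: rt_refl.
move=> S S' SS'; have := @C_case _ _ _ zero _ _ M (fun v => if v == w then S else Us v) w S'.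
rewrite eqxx => /(_ SS'); congr (rstep_tot _ _ (Case M _)).
by apply/funext => v; case: eqP.
Qed.

(** Stated for arbitrary families of specifications because the rules for repeat and while create
    holes with new indices, to which the induction hypothesis must apply. *)
Lemma hole_refines (S : prog) : concrete S -> wf S ->
  forall (L : Type) (P Q : L -> op R (Bas Sig)),
    (forall l, is_pred (Q l)) -> (forall l, triple (P l) (sem zero S) (Q l)) ->
    refines (Hole P Q) S.
Proof.
elim: S => [|qs|qs U|S1 IH1 S2 IH2|N S1 IH|qs m M Ss IH|qs B S1 IH|] //=.
- move=> _ _ L P Q Qp PQ; apply: rt_step; apply: H_skip => l.
  exact: (triple_dual _ (PQ l)).
- move=> _ _ L P Q Qp PQ; apply: rt_step; apply: H_init => l.
  by apply: (triple_dual _ (PQ l)); apply: init_dual.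
- move=> _ Uu L P Q Qp PQ; apply: rt_step; apply: H_unit => // l.
  by apply: (triple_dual _ (PQ l)); apply: unit_dual.
- move=> [c1 c2] [w1 w2] L P Q Qp PQ.
  have t1 := sem_transformer zero c1 w1; have t2 := sem_transformer zero c2 w2.
  have Rp l : is_pred (wp (sem zero S2) (Q l)) by apply: wp_pred.
  apply: refines_trans; first by apply: rt_step; apply: H_seq Rp.
  apply: refines_seq; [apply: IH1 | apply: IH2] => // l X psdX.
    by rewrite -wpP //; [apply: PQ | apply: transformer_psd].
  by rewrite -wpP.
- move=> c w L P Q Qp PQ; have t := sem_transformer zero c w.
  (* Preconditions of the remaining [N - j] passes, so [Rj l N] is [Q l]. *)
  pose Rj l j := iter (N - j) (wp (sem zero S1)) (Q l).
  have itp k l : is_pred (iter k (wp (sem zero S1)) (Q l)).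
    by elim: k => //= k ?; apply: wp_pred.
  have itd k l : dual_at (iter k (sem zero S1)) (Q l) (iter k (wp (sem zero S1)) (Q l)).
    elim: k => [//|k IHk] X psdX; rewrite iterSr /= IHk ?wpP //.
    exact: transformer_psd.
  apply: refines_trans.
    apply: rt_step; apply: (@H_repeat _ _ _ zero _ _ _ N Rj) => l.
    - by move=> j _; apply: itp.
    - by rewrite /Rj subn0; apply: (triple_dual _ (PQ l)); apply: itd.
    - by rewrite /Rj subnn; apply: lowner_refl.
  apply: (refines_congr (K := Repeat N)); first exact: C_repeat.
  apply: IH => // -[l j] /=; first exact: itp.
  move=> X psdX; rewrite wpP //; last exact: itp.
  (* Since [j < N], one more [wp] applied to [Rj l j.+1] is exactly [Rj l j]. *)
  by rewrite /Rj -[in leRHS]iterS -subSn // subSS.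
- move=> c [mM w] L P Q Qp PQ.
  have t v := sem_transformer zero (c v) (w v).
  apply: refines_trans.
    apply: rt_step; apply: (@H_case _ _ _ zero _ _ _ _ _ M
      (fun l v => wp (sem zero (Ss v)) (Q l))) => //.
      by move=> l v; apply: wp_pred.
    by move=> l; apply: (triple_dual _ (PQ l)); apply: case_dual.
  by apply: refines_case => v; apply: IH => // l X psdX; rewrite wpP.
- move=> c [Bp w] L P Q Qp PQ; have t := sem_transformer zero c w.
  pose Rn l := loop_invariant B (sem zero S1) (Q l).
  have Rp l k : is_pred (Rn l k) by apply: loop_invariant_pred.
  apply: refines_trans.
    apply: rt_step; apply: (@HT_while _ _ _ zero _ _ _ _ B Rn
      (fun l => loop_invariant_lim B (sem zero S1) (Q l))) => // l.
    - by move=> k; apply: loop_invariant_mono.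
    - exact: loop_invariant_cvg.
    - by apply: (triple_dual _ (PQ l)); apply: while_dual.
  apply: (refines_congr (K := While B)); first exact: C_while.
  apply: IH => // -[l k] /=; first exact: binary_pred.
  (* By construction [Rn l k.+1] is the weakest precondition of the postcondition in the hole, so
     the triple holds with equality. *)
  by move=> X psdX; rewrite wpP //; apply: binary_pred.
Qed.
End Refinement.

Theorem mainTheorem4 (R : realType) (V : finType) (Sig : V -> finType)
    (zero : forall q, Sig q) (P Q : op R (Bas Sig)) (S : prog R Sig) :
  is_pred P -> is_pred Q -> concrete S -> wf S ->
  models_tot zero P S Q ->
  refines_tot zero (hole1 P Q) S.
Proof.
move=> _ Qp c w PQ; apply: hole_refines => // _ X psdX.
have tS := sem_transformer zero c w; rewrite wpP //.
(* Validity is given on partial states only; by rescaling it already forces [P] below the weakest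
   precondition, hence the inequality for every PSD [X]. *)
apply: lowner_tr psdX; apply: partial_tr_lowner => Y psY.
by rewrite -wpP //; [apply: PQ | case: psY].
Qed.
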